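(* The language $L_3=\{\omega\in\{a,b,c\}^*:\ |\omega|_a=|\omega|_b=|\omega|_c\}$ is recognized by some QPA with probability $\frac23$: there is a QPA which accepts every $x\in L_3$ with probability at least $\frac23$ and rejects every $x\in\{a,b,c\}^*\setminus L_3$ with probability at least $\frac23$.
   Context: $|\omega|_i$ denotes the number of occurrences of the symbol $i$ in $\omega$. A QPA is a tuple $A=(Q,\Sigma,T,q_0,Q_a,Q_r,\delta)$ with $Q$ a finite set of states, $\Sigma$ a finite input alphabet, $T$ a finite stack alphabet, $q_0\in Q$, $Q_a,Q_r\subset Q$ disjoint, $\Gamma=\Sigma\cup\{\#,\$\}$ (end-markers), $\Delta=T\cup\{Z_0\}$ ($Z_0\notin T$ the stack base symbol), and $\delta:Q\times\Gamma\times\Delta\times Q\times\{\downarrow,\to\}\times\Delta^*\to\mathbb{C}$ such that whenever $\delta(q,\alpha,\beta,q',d,\omega)\ne0$: $|\omega|\le2$; if $|\omega|=2$ then $\omega_1=\beta$; if $\beta=Z_0$ then $\omega\in Z_0T^*$; if $\beta\ne Z_0$ then $\omega\in T^*$; and such that the evolution operator $U_A$ is unitary. A configuration is $|\nu_i q_j\nu_k,\omega_l\rangle$ with $q_j\in Q$, $\nu_i\nu_k\in\#\Sigma^*\$$, input head on the first symbol of $\nu_k$, $\omega_l\in Z_0T^*$ the stack with head on its last symbol; $C$ is the set of configurations, $H_A=\ell_2(C)$; for $c=|\nu_i q_j\sigma\nu_k,\omega_l\tau\rangle$, $U_A|c\rangle=\sum_{(q,d,\omega)}\delta(q_j,\sigma,\tau,q,d,\omega)|f(c,d,q),\omega_l\omega\rangle$,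 where $f(c,\downarrow,q)=\nu_i q\sigma\nu_k$, $f(c,\to,q)=\nu_i\sigma q\nu_k$. Recognition: $E_a,E_r,E_n$ are the subspaces spanned by configurations with state in $Q_a$, in $Q_r$, in neither; on input $x$ start in $|q_0\#x\$,Z_0\rangle$, repeatedly apply $U_A$ and measure w.r.t. $E_a\oplus E_r\oplus E_n$, halting on ``accept''/``reject'' and otherwise continuing from the normalized projection onto $E_n$; acceptance/rejection probability is the total probability of eventually halting with that outcome. *)

(* Defs.v *)
From HB Require Import structures.
From mathcomp Require Import all_boot all_order all_algebra.
From mathcomp Require Import complex.
From mathcomp Require Import all_classical reals ereal sequences Rstruct.

Set Implicit Arguments.
Unset Strict Implicit.
Unset Printing Implicit Defensive.

Import Order.TTheory GRing.Theory Num.Theory.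
Local Open Scope ring_scope.

Definition Rr : realType := Rdefinitions.R.
Notation Cx := (Rr[i]).

Definition cconj (z : Cx) : Cx := Complex (complex.Re z) (- complex.Im z).
Definition cnorm2 (z : Cx) : Rr := complex.Re z ^+ 2 + complex.Im z ^+ 2.

(* Input tape symbols  Gamma = Sigma U {#,$}:  inl s = s,  inr false = #,  inr true = $. *)
Definition Gamma (Sigma : finType) := (Sigma + bool)%type.
Definition lend {Sigma : finType} : Gamma Sigma := inr false.
Definition rend {Sigma : finType} : Gamma Sigma := inr true.

Definition Delta (T : finType) := option T.
Definition Z0 {T : finType} : Delta T := None.

(* Head directions: false = "stay" (down arrow), true = "move right". *)

Record qpa (Sigma Q T : finType) := QPA {
  q_init : Q;
  Q_acc : {set Q};
  Q_rej : {set Q};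
  delta : Q -> Gamma Sigma -> Delta T -> Q -> bool -> seq (Delta T) -> Cx
}.

Section QPA.
Variables (Sigma Q T : finType) (A : qpa Sigma Q T).

Definition delta_ok : Prop :=
  forall q a b q' d (w : seq (Delta T)), delta A q a b q' d w != 0 ->
    [/\ size w <= 2,
        (size w = 2 -> nth Z0 w 0 = b),
        (b = Z0 -> exists s : seq T, w = Z0 :: map Some s)
      & (b <> Z0 -> exists s : seq T, w = map Some s)]%N.

(* Configurations:  (state, whole input tape nu_i nu_k, head position = |nu_i|,
   stack content above Z0 (bottom first; the last item is the stack head)). *)
Definition config := (Q * seq (Gamma Sigma) * nat * seq T)%type.
Definition cstate (c : config) : Q := c.1.1.1.

Definition tape_of (x : seq Sigma) : seq (Gamma Sigma) :=
  lend :: rcons (map inl x) rend.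

Definition valid_config (c : config) : Prop :=
  let: (q, tp, p, s) := c in (exists x, tp = tape_of x) /\ (p < size tp)%N.

Definition of_full (w : seq (Delta T)) : option (seq T) :=
  if w is None :: r then (if all (fun o => o != None) r then Some (pmap id r) else None)
  else None.

Definition words2 : seq (seq (Delta T)) :=
  [:: [::]] ++ [seq [:: o] | o <- enum {: Delta T}]
            ++ [seq [:: o1; o2] | o1 <- enum {: Delta T}, o2 <- enum {: Delta T}].

Definition moves : seq (Q * bool * seq (Delta T)) :=
  [seq (qd.1, qd.2, w) | qd <- [seq (q', d) | q' <- enum Q, d <- [:: false; true]],
                         w <- words2].

Definition succ_of (c : config) (m : Q * bool * seq (Delta T)) : option config :=
  let: (q, tp, p, s) := c in
  let: (q', d, w) := m in
  if (p + d < size tp)%N then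
    if of_full (belast Z0 (map Some s) ++ w) is Some s' then Some (q', tp, (p + d)%N, s')
    else None
  else None.

Definition amp (c : config) (m : Q * bool * seq (Delta T)) : Cx :=
  let: (q, tp, p, s) := c in
  let: (q', d, w) := m in
  delta A q (nth lend tp p) (last Z0 (map Some s)) q' d w.

(* Finitely supported vectors of H_A, as formal sums  sum_i a_i |c_i>. *)
Definition vec := seq (Cx * config).

Definition stepU (c : config) : vec :=
  flatten [seq (if succ_of c m is Some c' then [:: (amp c m, c')] else [::]) | m <- moves].

Definition applyU (v : vec) : vec :=
  flatten [seq [seq (p.1 * e.1, e.2) | e <- stepU p.2] | p <- v].

Definition coef (v : vec) (c : config) : Cx := \sum_(p <- v | p.2 == c) p.1.

Definition inner (v w : vec) : Cx :=
  \sum_(c <- undup (map snd v ++ map snd w)) cconj (coef v c) * coef w c.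

Definition normsq (v : vec) : Rr :=
  \sum_(c <- undup (map snd v)) cnorm2 (coef v c).

Definition Uentry (d c : config) : Cx := coef (stepU c) d.

(* U_A is unitary on l2(C): its (column- and row-finite) matrix has orthonormal
   columns and orthonormal rows. *)
Definition U_unitary : Prop :=
  (forall c c', valid_config c -> valid_config c' ->
      inner (stepU c) (stepU c') = (c == c')%:R) /\
  (forall d d', valid_config d -> valid_config d' ->
      exists s : seq config,
        [/\ uniq s,
            (forall c, valid_config c -> Uentry d c != 0 \/ Uentry d' c != 0 -> c \in s)
          & \sum_(c <- s | `[< valid_config c >]) Uentry d c * cconj (Uentry d' c)
              = (d == d')%:R]).

Definition is_QPA : Prop := [disjoint Q_acc A & Q_rej A] /\ delta_ok /\ U_unitary.

Definition proj (P : {set Q}) (v : vec) : vec := [seq p <- v | cstate p.2 \in P].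
Definition projN (v : vec) : vec :=
  [seq p <- v | (cstate p.2 \notin Q_acc A) && (cstate p.2 \notin Q_rej A)].

Definition init (x : seq Sigma) : vec := [:: (1, (q_init A, tape_of x, 0%N, [::]))].

(* Unnormalized state after n non-halting steps. *)
Fixpoint psi (x : seq Sigma) (n : nat) : vec :=
  if n is n'.+1 then projN (applyU (psi x n')) else init x.

(* Probability of halting with "accept"/"reject" at step n+1. *)
Definition p_acc (x : seq Sigma) (n : nat) : Rr := normsq (proj (Q_acc A) (applyU (psi x n))).
Definition p_rej (x : seq Sigma) (n : nat) : Rr := normsq (proj (Q_rej A) (applyU (psi x n))).

Definition acc_prob (x : seq Sigma) : \bar Rr := (\sum_(0 <= n <oo) (p_acc x n)%:E)%E.
Definition rej_prob (x : seq Sigma) : \bar Rr := (\sum_(0 <= n <oo) (p_rej x n)%:E)%E.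

End QPA.

Definition sa : 'I_3 := inord 0.
Definition sb : 'I_3 := inord 1.
Definition sc : 'I_3 := inord 2.

Definition L3 (w : seq 'I_3) : Prop :=
  count_mem sa w = count_mem sb w /\ count_mem sb w = count_mem sc w.

(* Main.v *)
Require Import Defs.
From HB Require Import structures.
From mathcomp Require Import all_boot all_order all_algebra.
From mathcomp Require Import complex.
From mathcomp Require Import all_classical reals ereal sequences Rstruct.
From mathcomp Require Import zify lra.

(** The automaton runs three reversible counters in superposition, each with
    probability 1/3; the i-th one compares the numbers of letters i and i+1 (mod 3).
    On a word of L3 all three accept; on any other word at least two reject.

    The counters act on the input letters by a bijection of (state, stack) pairs, so
    the only obstacle to unitarity is at the ends of the tape, where the head can only
    leave # and only enter $.  It is removed by letting the stack alphabet consist of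
    the states themselves (the halting accepting ones excepted): at $, a pair (t, s)
    becomes (idle, s t), and at # the pair (idle, s t) is turned back into (t, s).
    Hence the pairs (idle, s) with s nonempty never need to move, all the others
    move right, and the deterministic part of the evolution is a bijection of the
    configurations.  This step is preceded by a 4x4 orthogonal matrix that sends the initial
    configuration to the uniform superposition of the three counters. *)

Set Implicit Arguments.
Unset Strict Implicit.
Unset Printing Implicit Defensive.
Import Order.TTheory GRing.Theory Num.Theory.
Local Open Scope ring_scope.
Local Open Scope complex_scope.

(** * Coefficients of formal sums of configurations *)

Section Coef.
Variables (Sigma Q T : finType).
Implicit Types (v w : vec Sigma Q T) (c d : config Sigma Q T).

Lemma coef_out v c : c \notin map snd v -> coef v c = 0.
Proof.
move=> cv; rewrite /coef big1_seq // => p /andP[/eqP pc pv].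
by case/negP: cv; rewrite -pc map_f.
Qed.

(** A configuration may occur several times in a formal sum; grouping equal ones shows that a linear
    functional sees only the coefficients. *)
Lemma big_coef v s (F : config Sigma Q T -> Cx) :
    uniq s -> {subset map snd v <= s} ->
  \sum_(p <- v) p.1 * F p.2 = \sum_(c <- s) coef v c * F c.
Proof.
move=> us vs; under [RHS]eq_bigr => c _ do rewrite /coef mulr_suml big_mkcond /=.
rewrite exchange_big /= !big_seq; apply: eq_bigr => p pv.
rewrite -big_mkcond /= -big_filter.
have -> : [seq i <- s | p.2 == i] = [:: p.2]; last by rewrite big_seq1.
rewrite (eq_filter (a2 := pred1 p.2)); last by move=> i; rewrite /= eq_sym.
by rewrite filter_pred1_uniq // vs // map_f.
Qed.

Lemma big_support (V : nmodType) v s (F : config Sigma Q T -> V) :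
    uniq s -> {subset map snd v <= s} -> (forall c, c \notin map snd v -> F c = 0) ->
  \sum_(c <- undup (map snd v)) F c = \sum_(c <- s) F c.
Proof.
move=> us vs F0.
rewrite [RHS](bigID (mem (map snd v))) /= [X in _ = _ + X]big1 ?addr0.
  rewrite -[RHS]big_filter; apply: perm_big; apply: uniq_perm.
  - exact: undup_uniq.
  - exact: filter_uniq.
  move=> c; rewrite mem_undup mem_filter.
  by case cv: (c \in _) => //=; rewrite vs.
by move=> c /F0.
Qed.

(** Squared moduli are nonnegative, so any duplicate-free selection of configurations bounds the
    norm from below. Halting probabilities are estimated this way. *)
Lemma normsq_ge v s : uniq s -> \sum_(c <- s) cnorm2 (coef v c) <= normsq v.
Proof.
move=> us; pose u := undup (s ++ map snd v).
have n0 (z : Cx) : 0 <= cnorm2 z by rewrite addr_ge0 // sqr_ge0.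
rewrite /normsq (@big_support _ _ u) ?undup_uniq //; last first.
- by move=> c /coef_out ->; rewrite /cnorm2 /= expr0n addr0.
- by move=> c; rewrite mem_undup mem_cat orbC => ->.
rewrite [leRHS](bigID (mem s)) /= -[X in X <= _]addr0 lerD ?sumr_ge0 //.
rewrite -[leRHS]big_filter le_eqVlt; apply/orP; left; apply/eqP; apply: perm_big.
apply: uniq_perm => //; first by rewrite filter_uniq ?undup_uniq.
by move=> c; rewrite mem_filter mem_undup mem_cat; case: (c \in s).
Qed.

Lemma coef_proj P v c : coef (Defs.proj P v) c = if cstate c \in P then coef v c else 0.
Proof.
rewrite /coef /Defs.proj big_filter_cond big_mkcondl /=; case: ifP => cP.
  by apply: eq_bigr => p /eqP ->; rewrite cP.
by rewrite big1 // => p /eqP ->; rewrite cP.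
Qed.

Variable A : qpa Sigma Q T.

Lemma projNE v : projN A v = Defs.proj (~: (Q_acc A :|: Q_rej A)) v.
Proof. by apply: eq_filter => p; rewrite !inE negb_or. Qed.

Lemma coef_applyU v d : coef (applyU A v) d = \sum_(p <- v) p.1 * Uentry A d p.2.
Proof.
rewrite /coef /applyU big_flatten /= big_map; apply: eq_bigr => p _.
by rewrite big_map /= /Uentry /coef mulr_sumr.
Qed.

(** Different lists can represent the same vector; this lets [psi] be replaced at every step by an
    explicit list. *)
Lemma coef_applyU_eq v w :
  coef v =1 coef w -> coef (applyU A v) =1 coef (applyU A w).
Proof.
move=> vw d; rewrite !coef_applyU; pose s := undup (map snd v ++ map snd w).
rewrite !(@big_coef _ s) ?undup_uniq //; last 2 first.
- by move=> c; rewrite mem_undup mem_cat orbC => ->.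
- by move=> c; rewrite mem_undup mem_cat => ->.
by apply: eq_bigr => c _; rewrite vw.
Qed.

End Coef.

(** * Enumeration of the moves *)

Section Moves.
Variables (Q T : finType).

Lemma size_words2 (w : seq (Delta T)) : (w \in words2 T) = (size w <= 2)%N.
Proof.
rewrite /words2 !mem_cat inE.
case: w => [|x [|y [|z w]]] //=; rewrite ?orbF.
- by rewrite map_f ?mem_enum.
- by apply/orP; right; apply: allpairs_f; rewrite mem_enum.
- by apply/negbTE/norP; split; [apply/mapP => -[] | apply/allpairsP => -[] [? ?] [_ _]].
Qed.

Lemma mem_moves (m : Q * bool * seq (Delta T)) :
  (m \in moves Q T) = (size m.2 <= 2)%N.
Proof.
case: m => [[q d] w]; rewrite -size_words2; apply/idP/idP => [|wT].
  by case/allpairsP => -[? ?] /= [_ + [_ _ ->]].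
apply/allpairsP; exists ((q, d), w); split => //.
by apply: allpairs_f; rewrite ?mem_enum //; case: (d).
Qed.

(** Guarantees that [stepU] counts each transition once. *)
Lemma uniq_moves : uniq (moves Q T).
Proof.
apply: allpairs_uniq => [||[[q d] w] [[q' d'] w'] _ _ [-> -> ->] //].
  by apply: allpairs_uniq => [||[q d] [q' d'] _ _ [-> ->] //]; rewrite ?enum_uniq.
have u2 : uniq [seq [:: o1; o2] | o1 <- enum {: Delta T}, o2 <- enum {: Delta T}].
  by apply: allpairs_uniq => [||[a b] [a' b'] _ _ [-> ->]] //; exact: enum_uniq.
have u1 : uniq [seq [:: o] | o <- enum {: Delta T}].
  by rewrite map_inj_uniq ?enum_uniq // => x y [].
rewrite /words2 !cat_uniq u1 u2 /= andbT; apply/andP; split.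
  rewrite -all_predC all_cat; apply/andP.
  by split; apply/allP => w; [move=> /mapP[? _ ->] | move=> /allpairsP[? [_ _ ->]]].
by apply/hasPn => w /allpairsP[? [_ _ ->]]; apply/mapP => -[].
Qed.

End Moves.

(** * Unitarity of a local mixing followed by a reversible step *)

Section Mixed.
Variables (Sigma Q T : finType).
Variable table : Q -> Gamma Sigma -> Delta T -> Q * bool * seq (Delta T).
Variable V : Gamma Sigma -> Delta T -> Q -> Q -> Rr.
Variables (q0 : Q) (acc rej : {set Q}).
Local Notation config := (config Sigma Q T).
Implicit Types (c d : config).

(* One step applies [V a b] to the state, then the deterministic [table]. *)
Definition mixed : qpa Sigma Q T := QPA q0 acc rej
  (fun q a b q' r w => (\sum_q1 V a b q1 q * (table q1 a b == (q', r, w))%:R)%:C).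

Definition scanned c : Gamma Sigma := nth lend c.1.1.2 c.1.2.
Definition top c : Delta T := last Z0 (map Some c.2).
Definition set_state q c : config := (q, c.1.1.2, c.1.2, c.2).
Definition step c : option config := succ_of c (table (cstate c) (scanned c) (top c)).

Local Arguments step : simpl never.

Lemma set_state_id c : set_state (cstate c) c = c.
Proof. by case: c => [[[]]]. Qed.

Lemma valid_set_state q c : valid_config c -> valid_config (set_state q c).
Proof. by case: c => [[[]]]. Qed.

Lemma stepE q tp p s : step (q, tp, p, s) =
  succ_of (q, tp, p, s) (table q (nth lend tp p) (last Z0 (map Some s))).
Proof. by []. Qed.

Lemma step_set_state q c :
  step (set_state q c) = succ_of c (table q (scanned c) (top c)).
Proof. by case: c => [[[? ?] ?] ?]; rewrite /step /=; case: table => [[]]. Qed.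

Hypothesis size_table : forall q a b, (size (table q a b).2 <= 2)%N.

(** For each intermediate state the table selects a single move, which lies in [moves] by the size
    bound. The sum over moves therefore collapses, and the evolution is the product of the mixing
    and the step. *)
Lemma Uentry_mixed c d :
  Uentry mixed d c =
  (\sum_q V (scanned c) (top c) q (cstate c) * (step (set_state q c) == Some d)%:R)%:C.
Proof.
rewrite /Uentry /coef /stepU big_flatten /= big_map.
rewrite (eq_bigr (fun m => (\sum_q V (scanned c) (top c) q (cstate c) *
    (table q (scanned c) (top c) == m)%:R * (succ_of c m == Some d)%:R)%:C)); last first.
  move=> m _; case E: succ_of => [c'|]; last first.
    by rewrite big_nil big1 // => q _; rewrite mulr0.
  rewrite big_cons big_nil /=.
  case: (eqVneq c' d) => [->|cd]; last first.
    rewrite (inj_eq (@Some_inj _)) (negPf cd).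
    by rewrite big1 // => q _; rewrite mulr0.
  rewrite eqxx addr0 /amp; case: c m {E} => [[[q tp] p] s] [[q' e] w] /=.
  by congr (_%:C); apply: eq_bigr => q1 _; rewrite mulr1.
rewrite -rmorph_sum exchange_big /=; congr (_%:C); apply: eq_bigr => q _.
have tm : table q (scanned c) (top c) \in moves Q T by rewrite mem_moves.
rewrite (bigD1_seq _ tm (uniq_moves _ _)) /= eqxx mulr1 big1 ?addr0; last first.
  by move=> m /negPf; rewrite eq_sym => ->; rewrite mulr0 mul0r.
congr (_ * _%:R).
by rewrite step_set_state.
Qed.

Lemma Uentry_unmixed c d :
    (forall q, V (scanned c) (top c) q (cstate c) = (q == cstate c)%:R) ->
  Uentry mixed d c = (step c == Some d)%:R.
Proof.
move=> Vc; rewrite Uentry_mixed (bigD1 (cstate c)) //= Vc eqxx mul1r set_state_id.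
by rewrite big1 ?addr0 ?rmorph_nat // => q /negPf qc; rewrite Vc qc mul0r.
Qed.

Lemma coef_applyU_unmixed (I : eqType) (r : seq I) (a : Cx) (c c' : I -> config) :
    (forall i q, i \in r ->
      V (scanned (c i)) (top (c i)) q (cstate (c i)) = (q == cstate (c i))%:R) ->
    (forall i, i \in r -> step (c i) = Some (c' i)) ->
  coef (applyU mixed [seq (a, c i) | i <- r]) =1 coef [seq (a, c' i) | i <- r].
Proof.
move=> Vc sc d; rewrite coef_applyU /coef !big_map [RHS]big_mkcond /= !big_seq.
apply: eq_bigr => i ir; rewrite Uentry_unmixed => [|q]; last exact: Vc.
rewrite sc // (inj_eq (@Some_inj _)).
by case: eqP => _; rewrite ?mulr1 ?mulr0.
Qed.

Hypothesis V_col : forall a b q q',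
  \sum_q1 V a b q1 q * V a b q1 q' = (q == q')%:R.
Hypothesis V_row : forall a b q q',
  \sum_q1 V a b q q1 * V a b q' q1 = (q == q')%:R.

Hypothesis step_inj : forall c c', valid_config c -> valid_config c' ->
  step c = step c' -> c = c'.
Hypothesis step_total : forall c, valid_config c -> step c <> None.
Hypothesis step_surj : forall d, valid_config d -> exists2 c, valid_config c & step c = Some d.

Lemma cconj_real (x : Rr) : cconj x%:C = x%:C.
Proof. by rewrite /cconj /= oppr0. Qed.

(** Mixing alters only the state, so row [d] is supported on the configurations that agree with the
    preimage [e] up to the state, and there it is a row of [V]. *)
Lemma Uentry_preimage c e d : valid_config c -> valid_config e -> step e = Some d ->
  Uentry mixed d c =
  (if c == set_state (cstate c) e then V (scanned e) (top e) (cstate e) (cstate c) else 0)%:C.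
Proof.
move=> vc ve ed; rewrite Uentry_mixed; congr (_%:C).
have E q : (step (set_state q c) == Some d) = (set_state q c == e).
  apply/eqP/eqP => [|->//]; rewrite -ed; apply: step_inj => //.
  exact: valid_set_state.
under eq_bigr => q _ do rewrite E.
case: ifP => [/eqP ce | ce].
  have -> : scanned c = scanned e by rewrite ce.
  have -> : top c = top e by rewrite ce.
  have Ee : set_state (cstate e) c = e by rewrite ce; exact: set_state_id.
  rewrite (bigD1 (cstate e)) //= big1 ?addr0 => [|q qe].
    by rewrite Ee eqxx mulr1.
  rewrite (_ : (_ == e) = false) ?mulr0 //.
  by apply: contraNF qe => /eqP <-; rewrite eqxx.
rewrite big1 // => q _; rewrite (_ : (_ == e) = false) ?mulr0 //.
by apply: contraFF ce => /eqP <-; apply/eqP/esym; exact: set_state_id.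
Qed.

(** The mixing is block diagonal, with one orthogonal block for each tape, head position and stack,
    and the step is a bijection. Columns thus reduce to [V_col] and rows to [V_row]. *)
Lemma U_unitary_mixed : U_unitary mixed.
Proof.
split => [c c' vc vc' | d d' vd vd'].
  rewrite /inner; set s := undup _.
  rewrite (eq_bigr (fun d => (\sum_q \sum_q' V (scanned c) (top c) q (cstate c) *
      V (scanned c') (top c') q' (cstate c') *
      ((step (set_state q c) == Some d) && (step (set_state q' c') == Some d))%:R)%:C));
    last first.
    move=> d _; rewrite -!/(Uentry _ _ _) !Uentry_mixed cconj_real -rmorphM.
    congr (_%:C); rewrite big_distrlr /=; apply: eq_bigr => q _; apply: eq_bigr => q' _.
    by rewrite mulrACA -natrM mulnb.
  rewrite -rmorph_sum exchange_big /=.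
  under eq_bigr => q _ do rewrite exchange_big /=.
  (* For fixed [q] and [q'], the sum over [d] is 1 exactly when the two images coincide, that is, by
     injectivity, when the configurations do. *)
  rewrite (eq_bigr (fun q => \sum_q' V (scanned c) (top c) q (cstate c) *
      V (scanned c') (top c') q' (cstate c') *
      (set_state q c == set_state q' c')%:R)); last first.
    move=> q _; apply: eq_bigr => q' _; rewrite -mulr_sumr; congr (_ * _).
    have vq := valid_set_state q vc; have vq' := valid_set_state q' vc'.
    case E: (step (set_state q c)) => [d|]; last by case: (step_total vq E).
    have ds : d \in s.
      rewrite mem_undup mem_cat; apply/orP; left.
      pose m := table q (scanned c) (top c).
      have Ed : succ_of c m = Some d by rewrite -E step_set_state.
      apply/mapP; exists (amp mixed c m, d) => //.
      apply/flattenP; exists [:: (amp mixed c m, d)]; last by rewrite inE.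
      by apply/mapP; exists m; rewrite ?Ed // mem_moves size_table.
    rewrite (bigD1_seq d) ?undup_uniq //= eqxx andTb big1 ?addr0; last first.
      by move=> e ed; rewrite (inj_eq (@Some_inj _)) eq_sym (negPf ed).
    congr (_%:R); congr nat_of_bool; apply/eqP/eqP => [E'|<-//].
    by apply: step_inj => //; rewrite E.
  (* Giving both configurations the common state [q0] tests whether they lie in the same block. *)
  have [cc'|cc'] := eqVneq (set_state q0 c) (set_state q0 c'); last first.
    rewrite big1 => [|q _]; last first.
      rewrite big1 // => q' _; rewrite (_ : (_ == _) = false) ?mulr0 //.
      by apply: contraNF cc' => /eqP E; apply/eqP; move: E => [_ ? ? ?]; congr (_, _, _, _).
    rewrite (_ : (c == c') = false) //.
    by apply: contraNF cc' => /eqP ->.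
  have [E1 E2 E3] : [/\ c.1.1.2 = c'.1.1.2, c.1.2 = c'.1.2 & c.2 = c'.2] by case: cc'.
  rewrite (_ : (c == c') = (cstate c == cstate c')); last first.
    move: E1 E2 E3; case: c c' {vc vc' s cc'} => [[[? ?] ?] ?] [[[? ?] ?] ?] /= -> -> ->.
    by rewrite /cstate /=; apply/eqP/eqP => [[->]|->].
  have -> : scanned c' = scanned c by rewrite /scanned E1 E2.
  have -> : top c' = top c by rewrite /top E3.
  rewrite -(rmorph_nat (real_complex Rr)) -(V_col (scanned c) (top c)); congr (_%:C).
  apply: eq_bigr => q _; rewrite (bigD1 q) //= big1 ?addr0.
    by rewrite /set_state E1 E2 E3 eqxx mulr1.
  move=> q' qq'; rewrite (_ : (_ == _) = false) ?mulr0 //.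
  by apply: contraNF qq' => /eqP -[->].
have [e ve ed] := step_surj vd; have [e' ve' ed'] := step_surj vd'.
(* The blocks of the two preimages contain the supports of both rows. *)
pose s := undup ([seq set_state q e | q <- enum Q] ++ [seq set_state q e' | q <- enum Q]).
exists s; split; first exact: undup_uniq.
  move=> c vc; rewrite mem_undup mem_cat.
  rewrite (Uentry_preimage vc ve ed) (Uentry_preimage vc ve' ed').
  case; case: ifP => [/eqP cE _|_]; rewrite ?eqxx //; apply/orP; [left|right].
    by apply/mapP; exists (cstate c); rewrite ?mem_enum.
  by apply/mapP; exists (cstate c); rewrite ?mem_enum.
rewrite (eq_bigr (fun c => ((if c == set_state (cstate c) e
      then V (scanned e) (top e) (cstate e) (cstate c) else 0) *
    (if c == set_state (cstate c) e'
      then V (scanned e') (top e') (cstate e') (cstate c) else 0))%:C)); last first.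
  move=> c /asboolP vc; rewrite (Uentry_preimage vc ve ed) (Uentry_preimage vc ve' ed').
  by rewrite cconj_real -rmorphM.
rewrite -rmorph_sum -(rmorph_nat (real_complex Rr)); congr (_%:C).
have [ee'|ee'] := eqVneq (set_state q0 e) (set_state q0 e'); last first.
  rewrite big1 => [|c _]; last first.
    case: eqP => [ce|_]; last by rewrite mul0r.
    case: eqP => [ce'|_]; last by rewrite mulr0.
    case/eqP: ee'; have := etrans (esym ce) ce'.
    by rewrite /set_state => -[-> -> ->].
  rewrite (_ : (d == d') = false) //; apply: contraNF ee' => /eqP dd'.
  by rewrite (step_inj ve ve') // ed ed' dd'.
have [E1 E2 E3] : [/\ e.1.1.2 = e'.1.1.2, e.1.2 = e'.1.2 & e.2 = e'.2] by case: ee'.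
have E q : set_state q e' = set_state q e by rewrite /set_state E1 E2 E3.
have -> : scanned e' = scanned e by rewrite /scanned E1 E2.
have -> : top e' = top e by rewrite /top E3.
have -> : (d == d') = (cstate e == cstate e').
  apply/eqP/eqP => [dd'|ee].
    by congr cstate; apply: step_inj => //; rewrite ed ed' dd'.
  by apply: Some_inj; rewrite -ed -ed' -(set_state_id e) -(set_state_id e') E ee.
rewrite -(V_row (scanned e) (top e)).
pose F c := V (scanned e) (top e) (cstate e) (cstate c) *
  V (scanned e) (top e) (cstate e') (cstate c).
rewrite (eq_bigr (fun c => if c == set_state (cstate c) e then F c else 0)); last first.
  by move=> c _; rewrite E; case: ifP; rewrite ?mulr0.
rewrite -big_mkcondr /= -big_filter (perm_big [seq set_state q e | q <- enum Q]) /=.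
  by rewrite big_map big_enum.
have inj : injective (set_state^~ e) by move=> q q' [].
apply: uniq_perm; [by rewrite filter_uniq ?undup_uniq | by rewrite map_inj_uniq ?enum_uniq |].
move=> c; rewrite mem_filter mem_undup mem_cat.
apply/andP/mapP => [[/andP[_ /eqP ->] _]|[q _ ->]].
  by exists (cstate c); rewrite ?mem_enum.
split; last by apply/orP; left; apply/mapP; exists q; rewrite ?mem_enum.
by rewrite eqxx andbT; apply/asboolP/valid_set_state.
Qed.

End Mixed.

Arguments step : simpl never.

(** * Stack moves and the transition table *)

Lemma of_full_map (T : finType) (s : seq T) : of_full (None :: map Some s) = Some s.
Proof.
rewrite /of_full; have -> : all (fun o : option T => o != None) (map Some s).
  by apply/allP => o /mapP[t _ ->].
by rewrite map_pK.
Qed.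

Section Succ.
Variables (Sigma Q T : finType) (q q' : Q) (tp : seq (Gamma Sigma)) (p : nat) (d : bool).
Implicit Types (s : seq T) (t : T).
Hypothesis dp_lt : (d + p < size tp)%N.

(** The new position is written [d + p] so that it reduces to [p.+1] or [p] once the direction is
    known. *)
Lemma succ_keep s : succ_of (q, tp, p, s) (q', d, [:: last Z0 (map Some s)]) =
  Some (q', tp, (d + p)%N, s).
Proof.
rewrite /succ_of [(p + d)%N]addnC dp_lt; case/lastP: s => [//|s t].
rewrite map_rcons last_rcons belast_rcons cat_cons cats1 -map_rcons.
by rewrite of_full_map.
Qed.

Lemma succ_push s t : succ_of (q, tp, p, s) (q', d, [:: last Z0 (map Some s); Some t]) =
  Some (q', tp, (d + p)%N, rcons s t).
Proof.
rewrite /succ_of [(p + d)%N]addnC dp_lt; case/lastP: s => [|s u].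
  by rewrite (of_full_map [:: t]).
rewrite map_rcons last_rcons belast_rcons cat_cons -cat_rcons cats1 -!map_rcons.
by rewrite of_full_map.
Qed.

Lemma succ_pop s t : succ_of (q, tp, p, rcons s t) (q', d, [::]) =
  Some (q', tp, (d + p)%N, s).
Proof.
by rewrite /succ_of [(p + d)%N]addnC dp_lt map_rcons belast_rcons cats0 of_full_map.
Qed.

End Succ.

(* [inl (Some i)] and [inr i] are the i-th counter holding a nonnegative, resp. negative,
   number; [inl None] is [idle], at once the initial state and the rejecting one.  The
   stack symbols are these states, [idle] also being the unit of the unary counters. *)
Definition stk : finType := (option 'I_3 + 'I_3)%type.
Definition st : finType := (stk + 'I_3)%type.
Definition idle : stk := inl None.
Definition ctr (i : 'I_3) (nonneg : bool) : stk := if nonneg then inl (Some i) else inr i.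
Definition accept (i : 'I_3) : st := inr i.
Definition run (t : stk) : st := inl t.

Definition eff (i s : 'I_3) : option bool :=
  if s == i then Some true else if s == i + 1 then Some false else None.

(* At $ the counter [(inl (Some i), [::])] accepts instead of becoming idle; the
   configuration [(idle, [:: ctr i true])] is then the image of [(accept i, [::])]. *)
Definition table (q : st) (a : Gamma 'I_3) (b : Delta stk) : st * bool * seq (Delta stk) :=
  match a, q with
  | inr false, inr i => (q, false, [:: b])
  | inr false, inl (inl None) =>
      if b is Some t then (run t, false, [::]) else (q, true, [:: b])
  | inr false, inl t => (q, true, [:: b])
  | inr true, inr i =>
      if b is None then (run idle, false, [:: b; Some (ctr i true)]) else (q, false, [:: b])
  | inr true, inl t =>
      if b is None then
        if t is inl (Some i) then (accept i, false, [:: b])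
        else (run idle, false, [:: b; Some t])
      else (run idle, false, [:: b; Some t])
  | inl s, inr i => (q, false, [:: b])
  | inl s, inl (inl None) => (q, b == Z0, [:: b])
  | inl s, inl t =>
      let: (i, nonneg) := match t with inl (Some i) => (i, true) | inl None => (0, true)
                          | inr i => (i, false) end in
      match eff i s with
      | None => (q, true, [:: b])
      | Some up => if up == nonneg then (q, true, [:: b; Some idle])
                   else if b == Some idle then (q, true, [::])
                   else (run (ctr i (~~ nonneg)), true, [:: b])
      end
  end.

(** Yields both the length bound and the format conditions of [delta_ok]: the bottom symbol is never
    popped. *)
Lemma table_wf q a b : let w := (table q a b).2 in
  [\/ w = [:: b], exists t, w = [:: b; Some t] | b != None /\ w = [::]].
Proof.
have keep w : w = [:: b] ->
  [\/ w = [:: b], exists t, w = [:: b; Some t] | b != None /\ w = [::]] by constructor 1.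
have push w t : w = [:: b; Some t] ->
  [\/ w = [:: b], exists t, w = [:: b; Some t] | b != None /\ w = [::]].
  by constructor 2; exists t.
rewrite /=; case: a q => [s|[]] [[[i|]|i]|i] /=; try exact: keep;
  try (by case: b keep push => [t|] keep push; first [exact: keep | exact: push | constructor 3]);
  (case: eff => [up|]; last exact: keep);
  (case: ifP => _; first exact: push);
  by case: ifP => [/eqP->|_]; [constructor 3|constructor 1].
Qed.

Lemma size_table q a b : (size (table q a b).2 <= 2)%N.
Proof. by case: (table_wf q a b) => [->|[t ->]|[_ ->]]. Qed.

Local Notation cfg := (config 'I_3 st stk).
Local Notation delta3 := (step table).

(** * Positions on the input tape *)

Section Tape.
Variable Sigma : finType.
Implicit Types (x : seq Sigma) (p : nat).

Lemma size_tape x : size (tape_of x) = (size x).+2.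
Proof. by rewrite /= size_rcons size_map. Qed.

Lemma nth_tape_end x : nth lend (tape_of x) (size x).+1 = rend.
Proof. by rewrite /= nth_rcons size_map ltnn eqxx. Qed.

Lemma nth_tape_letter x p s0 : (p < size x)%N -> nth lend (tape_of x) p.+1 = inl (nth s0 x p).
Proof. by move=> px; rewrite /= nth_rcons size_map px (nth_map s0). Qed.

Lemma tape_right x p : (p < size (tape_of x))%N -> nth lend (tape_of x) p != rend ->
  (p.+1 < size (tape_of x))%N.
Proof.
rewrite size_tape !ltnS leq_eqVlt => /predU1P[-> | //].
by rewrite nth_tape_end.
Qed.

Lemma tape_letterP x p : (p.+2 < size (tape_of x))%N ->
  exists l, nth lend (tape_of x) p.+1 = inl l.
Proof.
rewrite size_tape !ltnS => px; case: x px => // s0 x px.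
by exists (nth s0 (s0 :: x) p); exact: nth_tape_letter.
Qed.

Lemma tape_lend x p : (p.+1 < size (tape_of x))%N -> nth lend (tape_of x) p.+1 != lend.
Proof.
rewrite size_tape !ltnS leq_eqVlt => /predU1P[-> | px].
  by rewrite nth_tape_end.
by have [|l ->] := @tape_letterP x p; rewrite ?size_tape.
Qed.

Lemma tape_pred x p : (p.+1 < size (tape_of x))%N ->
  nth lend (tape_of x) p = lend \/ exists l, nth lend (tape_of x) p = inl l.
Proof. by case: p => [|p] px; [left | right; exact: tape_letterP]. Qed.

Lemma tape_pos x p : (p.+1 < size (tape_of x))%N ->
  nth lend (tape_of x) p.+1 = rend \/ exists l, nth lend (tape_of x) p.+1 = inl l.
Proof.
move=> px; case: (eqVneq (nth lend (tape_of x) p.+1) rend) => [|pr]; first by left.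
by right; apply/tape_letterP/tape_right.
Qed.

End Tape.

(** * Reversible signed counters *)

(** A step against the sign pops a unit, or flips the sign when no unit is on top. All stacks are
    covered, since the evolution must also be bijective on unreachable configurations. *)
Definition count_step (e : option bool) (c : bool * seq stk) : bool * seq stk :=
  if e is Some up then
    if up == c.1 then (c.1, rcons c.2 idle)
    else match rev c.2 with
         | inl None :: r => (c.1, rev r)
         | _ => (~~ c.1, c.2)
         end
  else c.

(** Push and pop undo each other. A flip is undone by a flip: the top is still no unit, and the
    opposite direction is again against the new sign. *)
Lemma count_stepK e : cancel (count_step e) (count_step (omap negb e)).
Proof.
by case: e => [[]|] [[] s] //=; case/lastP: s => [|s [[i|]|i]];
  rewrite ?rev_rcons /= ?(rev_rcons, rev_cons, revK) /=.
Qed.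

Lemma step_ctr i b x p s l :
    nth lend (tape_of x) p = inl l -> (p.+1 < size (tape_of x))%N ->
  let c := count_step (eff i l) (b, s) in
  step table (run (ctr i b), tape_of x, p, s) =
  Some (run (ctr i c.1), tape_of x, p.+1, c.2).
Proof.
move=> pl px; rewrite stepE pl.
have -> : table (run (ctr i b)) (inl l) (last Z0 (map Some s)) =
   match eff i l with
      | None => (run (ctr i b), true, [:: last Z0 (map Some s)])
      | Some up => if up == b then (run (ctr i b), true, [:: last Z0 (map Some s); Some idle])
                   else if last Z0 (map Some s) == Some idle then (run (ctr i b), true, [::])
                   else (run (ctr i (~~ b)), true, [:: last Z0 (map Some s)])
      end by case: b.
have keep q s' := @succ_keep _ _ stk (run (ctr i b)) q _ _ true px s'.
rewrite /count_step; case: eff => [up|]; last exact: keep.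
rewrite [(b, s).1]/=; case: ifP => ub.
  have := @succ_push _ _ stk (run (ctr i b)) (run (ctr i b)) _ _ true px s idle. by apply.
case/lastP: s => [|s t]; first by move: (keep (run (ctr i (~~ b))) [::]).
have ts : last Z0 (map Some (rcons s t)) = Some t by rewrite map_rcons last_rcons.
move: (keep (run (ctr i (~~ b))) (rcons s t)); rewrite ts rev_rcons.
by case: t {ts} => [[j|]|j] //= _; rewrite revK;
  exact: (@succ_pop _ _ stk (run (ctr i b)) (run (ctr i b)) _ _ true px s).
Qed.

(** * The deterministic step, according to the scanned symbol *)

Section Rules.
Variables (x : seq 'I_3) (p : nat).
Hypothesis px : (p < size (tape_of x))%N.
Local Notation tp := (tape_of x).
Local Notation step := (step table).

Lemma last_some (s : seq stk) t : last Z0 (map Some (rcons s t)) = Some t.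
Proof. by rewrite map_rcons last_rcons. Qed.

Lemma step_end t s : nth lend tp p = rend ->
  step (run t, tp, p, s) =
  Some (if s is [::] then if t is inl (Some i) then (accept i, tp, p, [::])
                          else (run idle, tp, p, [:: t])
        else (run idle, tp, p, rcons s t)).
Proof.
move=> pr; rewrite stepE pr.
have push := @succ_push _ _ stk (run t) (run idle) _ _ false px s t.
case/lastP: s push => [|s u] push.
  case: t push => [[i|]|i] push //.
  exact: (@succ_keep _ _ stk _ _ _ _ false px [::]).
rewrite last_some in push *; rewrite (_ : table _ _ _ = (run idle, false, [:: Some u; Some t])).
  by rewrite push; case: s {push}.
by case: t {push} => [[]|].
Qed.

Lemma step_accept i s :
  step (accept i, tp, p, s) =
  Some (if (nth lend tp p == rend) && (s == [::]) then (run idle, tp, p, [:: ctr i true])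
        else (accept i, tp, p, s)).
Proof.
rewrite stepE; case: ifP => [/andP[/eqP -> /eqP ->]|E].
  exact: (@succ_push _ _ stk (accept i) (run idle) _ _ false px [::]).
rewrite (_ : table _ _ _ = (accept i, false, [:: last Z0 (map Some s)])).
  exact: (@succ_keep _ _ stk _ _ _ _ false px).
case: nth E => [l|[]] // E.
case/lastP: s E => [|s t]; last by rewrite last_some.
by rewrite eqxx.
Qed.

Lemma step_idle : (p.+1 < size tp)%N ->
  step (run idle, tp, p, [::]) = Some (run idle, tp, p.+1, [::]).
Proof.
move=> px1.
rewrite stepE; case: (tape_pred px1) => [-> | [l ->]];
  exact: (@succ_keep _ _ stk _ _ _ _ true px1 [::]).
Qed.

Lemma step_idle_letter l s u : nth lend tp p = inl l ->
  step (run idle, tp, p, rcons s u) = Some (run idle, tp, p, rcons s u).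
Proof.
move=> pl; rewrite stepE pl.
by have := @succ_keep _ _ stk (run idle) (run idle) _ _ false px (rcons s u); rewrite last_some.
Qed.

Lemma step_idle_lend s u : nth lend tp p = lend ->
  step (run idle, tp, p, rcons s u) = Some (run u, tp, p, s).
Proof.
by move=> pl; rewrite stepE pl last_some; exact: (@succ_pop _ _ stk _ _ _ _ false px).
Qed.

Lemma step_ctr_lend i b s : nth lend tp p = lend -> (p.+1 < size tp)%N ->
  step (run (ctr i b), tp, p, s) = Some (run (ctr i b), tp, p.+1, s).
Proof.
move=> pl px1; by rewrite stepE pl; case: b; exact: (@succ_keep _ _ stk _ _ _ _ true px1).
Qed.

End Rules.

(** * The inverse of the step *)

(** A running state at position 0 was popped at #. Further right, the symbol to the left tells
    whether a counter left # or read a letter; [idle] above a nonempty stack is fixed on a letter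
    and comes from the step at $ otherwise. *)
Definition back (c : cfg) : cfg :=
  let: (q, tp, p, s) := c in
  match q, p with
  | inr i, _ =>
      if (nth lend tp p == rend) && (s == [::]) then (run (ctr i true), tp, p, s) else c
  | inl t, 0%N => (run idle, tp, p, rcons s t)
  | inl (inl None), p'.+1 =>
      if rev s is t :: r then
        if nth lend tp p == rend then
          match t, r with
          | inl (Some i), [::] => (accept i, tp, p, [::])
          | _, _ => (run t, tp, p, rev r)
          end
        else c
      else (q, tp, p', s)
  | inl t, p'.+1 =>
      if nth lend tp p' is inl l then
        let: (i, b) := match t with inl (Some i) => (i, true) | inl None => (0, true)
                       | inr i => (i, false) end in
        let: (b', s') := count_step (omap negb (eff i l)) (b, s) in
        (run (ctr i b'), tp, p', s')
      else (q, tp, p', s)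
  end.

Lemma valid_back c : valid_config c -> valid_config (back c).
Proof.
case: c => [[[q tp] p] s] [[x ->] px].
case: q p px => [[[i|]|i]|i] [|p] px //=; try (by split; [exists x | ]).
all: try (by split; [exists x | exact: ltnW]).
- by case: nth => [l|r]; [case: count_step => b' s' |]; split; try exists x => //; exact: ltnW.
- case: rev => [|t r]; first by split; [exists x | exact: ltnW].
  by case: ifP => _; [case: t r => [[i|]|i] [|t' r] | ]; split; try exists x.
- by case: nth => [l|r]; [case: count_step => b' s' |]; split; try exists x => //; exact: ltnW.
- by case: ifP => _; split; try exists x.
Qed.

Lemma stk_cases (t : stk) : t = idle \/ exists i b, t = ctr i b.
Proof.
by case: t => [[i|]|i]; [right; exists i, true | left | right; exists i, false].
Qed.

Lemma back_ctr_letter i b tp p s l : nth lend tp p = inl l ->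
  let c := count_step (omap negb (eff i l)) (b, s) in
  back (run (ctr i b), tp, p.+1, s) = (run (ctr i c.1), tp, p, c.2).
Proof. by move=> pl; case: b; rewrite /back pl /=; case: count_step. Qed.

Lemma back_ctr_lend i b tp p s : nth lend tp p = lend ->
  back (run (ctr i b), tp, p.+1, s) = (run (ctr i b), tp, p, s).
Proof. by move=> pl; case: b; rewrite /back pl. Qed.

Lemma back_accept i tp p s : back (accept i, tp, p, s) =
  if (nth lend tp p == rend) && (s == [::]) then (run (ctr i true), tp, p, s)
  else (accept i, tp, p, s).
Proof. by case: p. Qed.

Lemma back_start t tp s : back (run t, tp, 0%N, s) = (run idle, tp, 0%N, rcons s t).
Proof. by case: t => [[]|]. Qed.

Lemma count_step_negK e : cancel (count_step (omap negb e)) (count_step e).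
Proof. by move=> c; rewrite -{1}[e](omapK negbK) count_stepK. Qed.

Lemma step_back c : valid_config c -> step table (back c) = Some c.
Proof.
case: c => [[[q tp] p] s] [[x ->] px].
case: q => [t|i]; last first.
  rewrite back_accept; case: ifP => E; last by rewrite step_accept // E.
  by move: E => /andP[/eqP pr /eqP ->]; rewrite step_end.
case: p px => [|p] px; first by rewrite back_start step_idle_lend.
have px' := ltnW px.
have [->|[i [b ->]]] := stk_cases t; last first.
  case: (tape_pred px) => [pl|[l pl]]; first by rewrite back_ctr_lend // step_ctr_lend.
  rewrite (back_ctr_letter _ _ _ pl); case E: count_step => [b' s'] /=.
  by rewrite (step_ctr _ _ _ pl) //= -E count_step_negK.
case/lastP: s => [|s u]; first by rewrite /back step_idle.
rewrite /back rev_rcons; case: (tape_pos px) => [pr|[l pl]]; last first.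
  by rewrite pl (step_idle_letter _ _ _ pl).
(* Only a stack of exactly one symbol can come from an accepting state; a deeper one comes from
   pushing [u]. *)
rewrite pr eqxx; case/lastP: s => [|s v].
  case: u => [[i|]|i] /=; rewrite -/(tape_of x).
  - by rewrite step_accept // pr eqxx.
  - by rewrite step_end.
  - by rewrite step_end.
rewrite rev_rcons rev_cons revK (_ : (match u with inl (Some i) => _ | _ => _ end) =
  (run u, tape_of x, p.+1, rcons s v)); last by case: u => [[]|].
by rewrite step_end //; case: s.
Qed.

(** With [step_back] this makes [back] a two-sided inverse, so the step is total, injective and
    surjective. *)
Lemma step_total c : valid_config c ->
  exists d, [/\ valid_config d, step table c = Some d & back d = c].
Proof.
case: c => [[[q tp] p] s] [[x ->] px].
have vx q' p' s' : (p' < size (tape_of x))%N -> valid_config (q', tape_of x, p', s').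
  by split; first exists x.
case: q => [t|i]; last first.
  rewrite step_accept //; case: ifP => E.
    case/andP: E => /eqP pr /eqP ->.
    exists (run idle, tape_of x, p, [:: ctr i true]); split=> //; first exact: vx.
    by case: p px pr => [|p] px pr //; rewrite /back pr.
  by exists (accept i, tape_of x, p, s); split=> //; [exact: vx | rewrite back_accept E].
case: (eqVneq (nth lend (tape_of x) p) rend) => [pr | /(tape_right px) px1].
  rewrite step_end //; case: p px pr => [|p] px pr //; set d := (X in Some X); exists d.
  rewrite {}/d; split; last 1 first.
  - case/lastP: s => [|s v].
      case: t => [[i|]|i]; first by rewrite back_accept pr eqxx.
        by rewrite /back pr.
      by rewrite /back pr.
    rewrite (_ : (match rcons s v with [::] => _ | _ => _ end) =
      (run idle, tape_of x, p.+1, rcons (rcons s v) t)); last by case: s.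
    by rewrite /back !rev_rcons pr eqxx rev_cons revK; case: t => [[]|].
  - by case: s => [|v s]; first case: t => [[i|]|i]; exact: vx.
  by [].
have [->|[i [b ->]]] := stk_cases t; last first.
  case: (tape_pred px1) => [pl|[l pl]].
    exists (run (ctr i b), tape_of x, p.+1, s); split; first exact: vx.
      by rewrite step_ctr_lend.
    by rewrite back_ctr_lend.
  case E: (count_step (eff i l) (b, s)) => [b' s'].
  exists (run (ctr i b'), tape_of x, p.+1, s'); split; first exact: vx.
    by rewrite (step_ctr _ _ _ pl) // E.
  by rewrite (back_ctr_letter _ _ _ pl) /= -E count_stepK.
case/lastP: s => [|s u].
  exists (run idle, tape_of x, p.+1, [::]); split; first exact: vx.
    by rewrite step_idle.
  by [].
case: (tape_pred px1) => [pl|[l pl]].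
  exists (run u, tape_of x, p, s); split; first exact: vx.
    by rewrite step_idle_lend.
  (* The symbol # occurs only at position 0. *)
  case: p pl px px1 => [|p] pl px px1; first by rewrite back_start.
  by move: (tape_lend px); rewrite pl.
exists (run idle, tape_of x, p, rcons s u); split; first exact: vx.
  by rewrite (step_idle_letter _ _ _ pl).
case: p pl px px1 => [|p] pl px px1 //.
by rewrite /back rev_rcons pl.
Qed.

(** * The orthogonal mixing matrix of order four *)

Lemma ord3_cases (P : 'I_3 -> Prop) : P 0 -> P 1 -> P 2 -> forall i, P i.
Proof.
move=> P0 P1 P2 [[|[|[|//]]] lt_i]; [move: P0|move: P1|move: P2];
  by congr P; apply: val_inj.
Qed.

Lemma big_ord3 (R : nmodType) (F : 'I_3 -> R) : \sum_i F i = F 0 + F 1 + F 2.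
Proof.
rewrite !big_ord_recr big_ord0 /= add0r.
by congr (F _ + F _ + F _); apply: val_inj.
Qed.

Lemma big_option_sum (R : nmodType) (F : option 'I_3 -> R) :
  \sum_u F u = F None + F (Some 0) + F (Some 1) + F (Some 2).
Proof.
rewrite (bigD1 None) //= -!addrA; congr (_ + _).
rewrite (reindex_omap Some id) /=; last by case.
by under eq_bigl => i do rewrite eqxx; rewrite big_ord3 addrA.
Qed.

(* The skew conference matrix of order 4: its rows are orthogonal, of squared norm 3. *)
Definition skew (u v : option 'I_3) : Rr :=
  match u, v with
  | None, None => 0
  | Some _, None => 1
  | None, Some _ => - 1
  | Some i, Some j => if i == j then 0 else if j == i + 1 then 1 else - 1
  end.

(** Antisymmetry transfers the row relations to the columns. *)
Lemma skewN u v : skew v u = - skew u v.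
Proof.
by case: u v => [i|] [j|] /=; rewrite ?oppr0 ?opprK //;
  elim/ord3_cases: i; elim/ord3_cases: j; rewrite /= ?oppr0 ?opprK.
Qed.

Lemma skew_row u v : \sum_w skew u w * skew v w = 3 * (u == v)%:R.
Proof.
rewrite big_option_sum.
case: u v => [i|] [j|]; try elim/ord3_cases: i; try elim/ord3_cases: j;
  rewrite /= ?mulr0 ?mul0r ?mulrN ?mulNr ?mulr1 ?mul1r; try lra.
Qed.

Lemma skew_col u v : \sum_w skew w u * skew w v = 3 * (u == v)%:R.
Proof.
by rewrite -skew_row; apply: eq_bigr => w _; rewrite skewN [skew w v]skewN mulrNN.
Qed.

Definition rsqrt3 : Rr := (Num.sqrt 3)^-1.
Lemma rsqrt3_sqr : rsqrt3 ^+ 2 = 3^-1.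
Proof. by rewrite exprVn sqr_sqrtr ?ler0n. Qed.

(** Column [None] of [skew] is 0 at [None] and 1 elsewhere, so [idle] is sent to the uniform
    superposition of the three nonnegative counters and keeps no amplitude itself. *)
Definition mix (q1 q : st) : Rr :=
  match q1, q with
  | inl (inl u), inl (inl v) => rsqrt3 * skew u v
  | _, _ => (q1 == q)%:R
  end.

Definition mixing (q : st) : bool := if q is inl (inl _) then true else false.

Lemma mixN q q1 : ~~ mixing q -> mix q q1 = (q == q1)%:R.
Proof. by case: q => [[]|]. Qed.

Lemma mixNr q q1 : ~~ mixing q -> mix q1 q = (q1 == q)%:R.
Proof. by case: q q1 => [[]|] // ? [[]|]. Qed.

Lemma sum_delta (F : st -> Rr) q : \sum_q1 (q == q1)%:R * F q1 = F q.
Proof.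
rewrite (bigD1 q) //= eqxx mul1r big1 ?addr0 // => q1 qq1.
by rewrite eq_sym (negPf qq1) mul0r.
Qed.

Lemma rsqrt3_sum (f g : option 'I_3 -> Rr) :
  \sum_w rsqrt3 * f w * (rsqrt3 * g w) = 3^-1 * \sum_w f w * g w.
Proof.
by rewrite mulr_sumr; apply: eq_bigr => w _; rewrite mulrACA -expr2 rsqrt3_sqr.
Qed.

Lemma mix_row q q' : \sum_q1 mix q q1 * mix q' q1 = (q == q')%:R.
Proof.
have [mq|mq] := boolP (mixing q); last first.
  by under eq_bigr do rewrite mixN //; rewrite sum_delta mixNr // eq_sym.
have [mq'|mq'] := boolP (mixing q'); last first.
  by under eq_bigr do rewrite mulrC (mixN _ mq'); rewrite sum_delta mixNr.
case: q q' mq mq' => [[u|]|] // [[v|]|] // _ _.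
rewrite !big_sumType /= [X in _ + X + _]big1 ?[X in _ + X]big1 ?addr0 => [|i _|i _];
  rewrite ?mul0r //.
by rewrite rsqrt3_sum skew_row mulrA mulVf ?mul1r // pnatr_eq0.
Qed.

Lemma mix_col q q' : \sum_q1 mix q1 q * mix q1 q' = (q == q')%:R.
Proof.
have [mq|mq] := boolP (mixing q); last first.
  under eq_bigr do rewrite mixNr // eq_sym.
  by rewrite sum_delta mixN.
have [mq'|mq'] := boolP (mixing q'); last first.
  under eq_bigr do rewrite mulrC (mixNr _ mq') eq_sym.
  by rewrite sum_delta mixN // eq_sym.
case: q q' mq mq' => [[u|]|] // [[v|]|] // _ _.
rewrite !big_sumType /= [X in _ + X + _]big1 ?[X in _ + X]big1 ?addr0 => [|i _|i _];
  rewrite ?mul0r //.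
by rewrite rsqrt3_sum skew_col mulrA mulVf ?mul1r // pnatr_eq0.
Qed.

(** * The automaton and its unitarity *)

(** The initial configuration scans # above an empty stack; after the first step the three branches
    never scan # again, so they are mixed only once. *)
Definition Vmix (a : Gamma 'I_3) (b : Delta stk) (q1 q : st) : Rr :=
  if (a == lend) && (b == Z0) then mix q1 q else (q1 == q)%:R.

Definition A3 : qpa 'I_3 st stk :=
  mixed table Vmix (run idle) [set accept i | i : 'I_3] [set run idle].

Lemma delta_ok_A3 : delta_ok A3.
Proof.
move=> q a b q' r w.
(* A nonzero amplitude comes from some [q1] whose table entry is this very move; otherwise all terms
   vanish. *)
have [q1 /eqP tq _|no] := pickP (fun q1 => table q1 a b == (q', r, w)); last first.
  by rewrite /= big1 ?eqxx // => q1 _; rewrite no mulr0.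
have := table_wf q1 a b; rewrite tq /= => -[->|[t ->]|[bN ->]]; split=> //.
- by move=> ->; exists [::].
- by case: b {tq} => // t _; exists [:: t].
- by move=> ->; exists [:: t].
- by case: b {tq} => // u _; exists [:: u; t].
- by move=> b0; rewrite b0 in bN.
- by exists [::].
Qed.

Lemma is_QPA_A3 : is_QPA A3.
Proof.
split; [|split; [exact: delta_ok_A3|]].
  by rewrite /= disjoint_sym disjoints1; apply/imsetP => -[].
apply: U_unitary_mixed.
- exact: size_table.
- move=> a b q q'; rewrite /Vmix; case: (_ && _); first exact: mix_col.
  by under eq_bigr do rewrite (eq_sym _ q); rewrite sum_delta.
- move=> a b q q'; rewrite /Vmix; case: (_ && _); first exact: mix_row.
  by rewrite sum_delta eq_sym.
- move=> c c' /step_total[d [_ -> <-]] /step_total[d' [_ -> <-]].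
  by case=> ->.
- by move=> c /step_total[d [_ ->]].
- by move=> d vd; exists (back d); [exact: valid_back | exact: step_back].
Qed.

(* [Negz h] is [- (h + 1)], so that the two halves of [int] match the two counter states. *)
Definition encode (z : int) : bool * seq stk :=
  match z with Posz h => (true, nseq h idle) | Negz h => (false, nseq h idle) end.

(** * Counter values as differences of letter counts *)

Definition weight (i l : 'I_3) : int := (l == i)%:Z - (l == i + 1)%:Z.
Definition excess (i : 'I_3) (w : seq 'I_3) : int := (count_mem i w)%:Z - (count_mem (i + 1) w)%:Z.

Lemma excess_rcons i w l : excess i (rcons w l) = excess i w + weight i l.
Proof.
by rewrite /excess /weight -cats1 !count_cat /= !addn0 !PoszD opprD addrACA.
Qed.

(** Passing between 0 and -1 exchanges [Posz 0] and [Negz 0], both with empty stack: this is the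
    sign flip. All other changes push or pop a unit. *)
Lemma count_step_encode i l z : count_step (eff i l) (encode z) = encode (z + weight i l).
Proof.
have rn h : rcons (nseq h idle) idle = nseq h.+1 idle by elim: h => //= h ->.
have i1 : (i == i + 1) = false by elim/ord3_cases: i.
have revS h : rev (nseq h.+1 idle) = idle :: nseq h idle by rewrite rev_nseq.
have NSD h : Negz h.+1 + 1 = Negz h by rewrite !NegzE; lia.
have PSB h : Posz h.+1 - 1 = Posz h by lia.
have NB h : Negz h - 1 = Negz h.+1 by rewrite !NegzE; lia.
rewrite /eff /weight; case: eqP => [->|_].
  rewrite i1 subr0; case: z => [h|[|h]].
  - by rewrite -PoszD addn1 /= rn.
  - by [].
  - by rewrite NSD /count_step /= revS /= rev_nseq.
rewrite sub0r; case: eqP => _; last by rewrite oppr0 addr0.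
case: z => [[|h]|h].
- by [].
- by rewrite PSB /count_step /= revS /= rev_nseq.
- by rewrite NB /= rn.
Qed.

(** * The run on an input word *)

Section Run.
Variable x : seq 'I_3.

(** The head stands at [k.+1] after [k] letters because # occupies position 0. *)
Definition branch (k : nat) (i : 'I_3) : config 'I_3 st stk :=
  let c := encode (excess i (take k x)) in (run (ctr i c.1), tape_of x, k.+1, c.2).

Lemma step_branch k i : (k < size x)%N -> step table (branch k i) = Some (branch k.+1 i).
Proof.
move=> kx; rewrite /branch; have [s0 _] : exists s0 : 'I_3, true by exists 0.
rewrite (step_ctr _ _ _ (nth_tape_letter s0 kx)) ?size_tape //.
by rewrite -surjective_pairing count_step_encode -excess_rcons -take_nth.
Qed.

Definition final (i : 'I_3) : config 'I_3 st stk :=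
  let c := encode (excess i x) in
  if excess i x == 0 then (accept i, tape_of x, (size x).+1, [::])
  else (run idle, tape_of x, (size x).+1, rcons c.2 (ctr i c.1)).

(** A nonnegative state with empty stack is exactly the code of 0, so the test made at $ is whether
    the excess vanishes. *)
Lemma step_final i : step table (branch (size x) i) = Some (final i).
Proof.
rewrite /branch take_size step_end ?size_tape ?nth_tape_end // /final.
by case: (excess i x) => [[|h]|[|h]].
Qed.

(** The accepting state, or the top of the stack, remembers the counter. Hence the branches do not
    interfere and their probabilities add up. *)
Lemma final_inj : injective final.
Proof.
move=> i j; rewrite /final; do 2!case: eqP => _ //; first by case.
by case=> /rcons_inj[_]; case: (encode _).1; case: (encode _).1 => -[].
Qed.

Definition spread (c : 'I_3 -> config 'I_3 st stk) : vec 'I_3 st stk :=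
  [seq (rsqrt3%:C, c i) | i <- enum 'I_3].

Lemma projN_spread c : (forall i, exists j b, cstate (c i) = run (ctr j b)) ->
  projN A3 (spread c) = spread c.
Proof.
move=> cr; apply/all_filterP/allP => p /mapP[i _ ->] /=.
have [j [b ->]] := cr i; rewrite !inE; apply/andP; split.
  by apply/imsetP => -[].
by case: b.
Qed.

Lemma unmixed_branch k i q : (k <= size x)%N ->
  let c := branch k i in Vmix (scanned c) (top c) q (cstate c) = (q == cstate c)%:R.
Proof.
move=> kx; rewrite /Vmix /scanned /= -/(tape_of x).
by rewrite (negPf (tape_lend _)) // size_tape !ltnS.
Qed.

Lemma coef_applyU_branch k c : (k <= size x)%N ->
    (forall i, step table (branch k i) = Some (c i)) ->
  coef (applyU A3 (spread (branch k))) =1 coef (spread c).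
Proof.
move=> kx bc; apply: coef_applyU_unmixed; first exact: size_table.
- by move=> i q _; exact: unmixed_branch.
- by move=> i _.
Qed.

Lemma coef_projN v w : coef v =1 coef w -> coef (projN A3 v) =1 coef (projN A3 w).
Proof. by move=> vw c; rewrite !projNE !coef_proj vw. Qed.

Lemma coef_psi0 : coef (applyU A3 (init A3 x)) =1 coef (spread (branch 0)).
Proof.
move=> d; rewrite coef_applyU big_seq1 mul1r Uentry_mixed; last exact: size_table.
rewrite /coef big_map big_enum_cond /=.
rewrite -[LHS]/((\sum_q mix q (run idle) *
  (step table (q, tape_of x, 0%N, [::]) == Some d)%:R)%:C).
have start i : step table (inl (inl (Some i)), tape_of x, 0%N, [::]) = Some (branch 0 i).
  have := @step_ctr_lend x 0 i true [::] erefl.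
  by rewrite size_tape /branch take0 /excess subrr => ->.
rewrite !big_sumType /= [X in _ + X + _]big1 ?[X in _ + X]big1 => [|i _|i _]; rewrite ?mul0r //.
rewrite big_option_sum /= mulr0 mul0r add0r !addr0 !start !mulr1.
rewrite [RHS]big_mkcond big_ord3 /=.
rewrite !(inj_eq (@Some_inj _)) !rmorphD !rmorphM !rmorph_nat /=.
by congr (_ + _ + _); case: eqP => _; rewrite ?mulr1 ?mulr0.
Qed.

(** One step leaves # and each letter takes one more, whence [k.+1]. No branch halts meanwhile, so
    the projection changes nothing. *)
Lemma coef_psi k : (k <= size x)%N -> coef (psi A3 x k.+1) =1 coef (spread (branch k)).
Proof.
have pb k' : projN A3 (spread (branch k')) = spread (branch k').
  by apply: projN_spread => i; eexists; eexists.
elim: k => [|k IHk] kx; first by rewrite -pb; apply/coef_projN/coef_psi0.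
rewrite -pb; apply: coef_projN => c.
rewrite (coef_applyU_eq _ (IHk (ltnW kx))).
by rewrite (coef_applyU_branch (c := branch k.+1)) ?(ltnW kx) // => i; exact: step_branch.
Qed.

Lemma coef_final : coef (applyU A3 (psi A3 x (size x).+1)) =1 coef (spread final).
Proof.
move=> c; rewrite (coef_applyU_eq _ (coef_psi (leqnn _))).
by rewrite (coef_applyU_branch (c := final)) // => i; exact: step_final.
Qed.

(** Each final configuration carries squared amplitude 1/3, and [final_inj] keeps them apart. *)
Lemma normsq_final (P : {set st}) (J : pred 'I_3) : (forall i, J i -> cstate (final i) \in P) ->
  \sum_i (J i)%:R / 3 <= normsq (Defs.proj P (applyU A3 (psi A3 x (size x).+1))).
Proof.
move=> JP; set v := Defs.proj _ _.
have us : uniq [seq final i | i <- enum 'I_3 & J i].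
  by rewrite (map_inj_uniq final_inj) filter_uniq ?enum_uniq.
apply: le_trans (normsq_ge v us).
rewrite big_map big_filter big_enum_cond /= big_mkcond [leRHS]big_mkcond /=.
apply: ler_sum => i _; rewrite ?inE; case: ifP => Ji; rewrite ?mul0r //.
rewrite coef_proj JP // coef_final /coef big_map.
rewrite big_enum_cond /= (big_pred1 i) => [|j]; last by rewrite /= (inj_eq final_inj).
by rewrite /cnorm2 /= expr0n addr0 rsqrt3_sqr mul1r.
Qed.

End Run.

(** * Acceptance and rejection probabilities *)

Lemma nneseries_term (u : nat -> Rr) n : (forall k, 0 <= u k) ->
  ((u n)%:E <= \sum_(0 <= k <oo) (u k)%:E)%E.
Proof.
move=> u0; apply: (@le_trans _ _ (\sum_(0 <= k < n.+1) (u k)%:E)%E).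
  by rewrite big_nat_recr //= leeDr // sume_ge0 // => i _; rewrite lee_fin.
by apply: nneseries_lim_ge => i _; rewrite lee_fin.
Qed.

Lemma normsq_ge0 (Sigma Q T : finType) (v : vec Sigma Q T) : 0 <= normsq v.
Proof. by rewrite sumr_ge0 // => c _; rewrite addr_ge0 // sqr_ge0. Qed.

Lemma excess_eq0 i x : (excess i x == 0) = (count_mem i x == count_mem (i + 1) x).
Proof. by rewrite subr_eq0. Qed.

Theorem theorem4 :
  exists (Q T : finType) (A : qpa 'I_3 Q T), is_QPA A /\
    forall x : seq 'I_3,
      (L3 x -> ((2 / 3 : Rr)%:E <= acc_prob A x)%E) /\
      (~ L3 x -> ((2 / 3 : Rr)%:E <= rej_prob A x)%E).
Proof.
exists st, stk, A3; split; first exact: is_QPA_A3.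
move=> x.
have saE : sa = 0 by apply: val_inj; rewrite /= inordK.
have sbE : sb = 1 by apply: val_inj; rewrite /= inordK.
have scE : sc = 2 by apply: val_inj; rewrite /= inordK.
have s2 : 1 + 1 = 2 :> 'I_3 by apply: val_inj.
have s0 : 2 + 1 = 0 :> 'I_3 by apply: val_inj.
rewrite /L3 saE sbE scE; split=> [[e01 e12]|nL].
  (* After [(size x).+1] steps every branch scans $, and the next measurement halts all of them. *)
  apply: le_trans (nneseries_term (size x).+1 (fun k => normsq_ge0 _)).
  rewrite lee_fin; apply: le_trans (normsq_final (J := predT) _); first by rewrite big_ord3 /=; lra.
  move=> i _; rewrite /final excess_eq0 (_ : _ == _ = true) ?imset_f //.
  by elim/ord3_cases: i; rewrite ?add0r ?s2 ?s0 ?e01 ?e12 eqxx.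
apply: le_trans (nneseries_term (size x).+1 (fun k => normsq_ge0 _)).
rewrite lee_fin.
apply: le_trans (normsq_final (J := fun i => excess i x != 0) _); last first.
  by move=> i /negPf Ei; rewrite /final Ei inE.
rewrite big_ord3 !excess_eq0 add0r s2 s0.
(* If three numbers are not all equal, at most one of the cyclic comparisons holds, so at least two
   counters reject. *)
case: (eqVneq (count_mem 0 x) (count_mem 1 x)) => [e01|n01];
case: (eqVneq (count_mem 1 x) (count_mem 2 x)) => [e12|n12].
- by case: nL.
- by rewrite eq_sym e01 n12 /=; lra.
- by rewrite -e12 eq_sym n01 /=; lra.
- by case: (_ != _); rewrite /=; lra.
Qed.
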